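(* Let $G=(V,E)$ be a finite simple undirected graph, let $\mathcal{S}=\prod_{i\in V}\mathcal{S}_i$ with each $\mathcal{S}_i$ finite and nonempty, and let $\Phi\colon\mathcal{S}\to\mathbb{R}$ be a potential of the form $\Phi(a)=\sum_{C\in\mathcal{C}(G)}\Phi^C(a^C)$ for functions $\Phi^C\colon\prod_{i\in C}\mathcal{S}_i\to\mathbb{R}$. (1) For every choice of functions $f_i\colon\mathcal{S}^{N(i)}\to\mathbb{R}$, $i\in V$, the game with payoffs $$u_i(a)=\sum_{C\in\mathcal{C}(G)\,:\,i\in C}\Phi^C(a^C)+f_i(a^{N(i)})\qquad(i\in V,\ a\in\mathcal{S})$$ is a graphical game on $G$ and a potential game with potential $\Phi$. (2) Conversely, for every game with strategy profile set $\mathcal{S}$ that is a graphical game on $G$ and a potential game with potential $\Phi$, there exist functions $f_i\colon\mathcal{S}^{N(i)}\to\mathbb{R}$, $i\in V$, such that its payoffs are given by the displayed formula.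
   Context: A game has a finite player set $V$; each player $i\in V$ has a finite strategy set $\mathcal{S}_i$; $\mathcal{S}=\prod_{i\in V}\mathcal{S}_i$ is the set of strategy profiles; player $i$ has a real-valued utility (payoff) $u_i\colon\mathcal{S}\to\mathbb{R}$. Fix an arbitrary distinguished strategy $o_i\in\mathcal{S}_i$ for each $i$; for $a\in\mathcal{S}$, $a^i$ denotes the profile obtained from $a$ by replacing $a_i$ with $o_i$. Graphical game on $G$: whenever $i\ne j$ and $(i,j)\notin E$, $u_i(a)=u_i(a^j)$ for all $a\in\mathcal{S}$ (this does not depend on the choice of the $o_i$). Potential game with potential $\Phi\colon\mathcal{S}\to\mathbb{R}$: $u_i(a)-u_i(a^i)=\Phi(a)-\Phi(a^i)$ for all $i\in V$, $a\in\mathcal{S}$. Potentials of a given game differ by constants; by convention potentials are normalized so that $\sum_{a\in\mathcal{S}}e^{\Phi(a)}=1$. $\mathcal{C}(G)$ is the set of maximal cliques of $G$, i.e. cliques not contained in strictly larger cliques (an isolated vertex is a maximal clique of size one). For $W\subseteq V$, $a^W\in\prod_{i\in W}\mathcal{S}_i$ denotes the restriction of $a$ to $W$. $N(i)$ is the set of neighbors of $i$ in $G$, excluding $i$, and $\mathcal{S}^{N(i)}=\prod_{j\in N(i)}\mathcal{S}_j$. *)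

(* Defs.v *)
From HB Require Import structures.
From mathcomp Require Import all_boot all_order all_algebra.
From mathcomp Require Import reals.

Set Implicit Arguments.
Unset Strict Implicit.
Unset Printing Implicit Defensive.

Import Order.TTheory GRing.Theory Num.Theory.

Local Open Scope ring_scope.

(** Graphs on [V] are relations [e : rel V]; [symmetric e] and [irreflexive e]
    are hypotheses of the theorem. *)

Definition clique (V : finType) (e : rel V) (C : {set V}) : bool :=
  [forall x in C, forall y in C, (x != y) ==> e x y].

Definition max_cliques (V : finType) (e : rel V) : {set {set V}} :=
  [set C | maxset (clique e) C].

Definition neighbors (V : finType) (e : rel V) (i : V) : {set V} :=
  [set j | e i j].

Definition profile (V : finType) (S : V -> finType) : Type :=
  {dffun forall i : V, S i}.

Definition subprofile (V : finType) (S : V -> finType) (W : {set V}) : Type :=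
  {dffun forall i : {j : V | j \in W}, S (val i)}.

Definition restrict (V : finType) (S : V -> finType) (W : {set V})
    (a : profile S) : subprofile S W :=
  [ffun i : {j : V | j \in W} => a (val i)].

(** The profile written [a^j]. *)
Definition reset (V : finType) (S : V -> finType) (o : forall i : V, S i)
    (j : V) (a : profile S) : profile S :=
  [ffun i : V => dfwith a (o j) i].

Definition graphical_game (R : realType) (V : finType) (e : rel V)
    (S : V -> finType) (o : forall i : V, S i)
    (u : V -> profile S -> R) : Prop :=
  forall i j : V, i != j -> ~~ e i j ->
  forall a : profile S, u i a = u i (reset o j a).

(** Only differences of [Phi] occur, so no normalization
    [\sum_a expR (Phi a) = 1] of the potential is imposed. *)
Definition potential_game (R : realType) (V : finType)
    (S : V -> finType) (o : forall i : V, S i)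
    (u : V -> profile S -> R) (Phi : profile S -> R) : Prop :=
  forall (i : V) (a : profile S),
    u i a - u i (reset o i a) = Phi a - Phi (reset o i a).

(** [PhiC] is indexed by all subsets of [V], but its values at sets that are not
    maximal cliques are never used. *)
Definition clique_payoff (R : realType) (V : finType) (e : rel V)
    (S : V -> finType) (PhiC : forall C : {set V}, subprofile S C -> R)
    (f : forall i : V, subprofile S (neighbors e i) -> R)
    (i : V) (a : profile S) : R :=
  \sum_(C in max_cliques e | i \in C) PhiC C (restrict C a)
  + f i (restrict (neighbors e i) a).

(* Main.v *)
(** The clique sum over [C] containing [i] already satisfies the equations of a
    game with potential [Phi], since cliques avoiding [i] cancel in
    [Phi a - Phi (a^i)].  Subtracting it from an arbitrary solution [u i] leaves
    a function unchanged by resetting any coordinate outside the neighborhood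
    of [i], [i] itself included, hence a function of the neighbors only. *)

Require Import Defs.
From HB Require Import structures.
From mathcomp Require Import all_boot all_order all_algebra.
From mathcomp Require Import reals.

Set Implicit Arguments.
Unset Strict Implicit.
Unset Printing Implicit Defensive.

Import Order.TTheory GRing.Theory Num.Theory.

Local Open Scope ring_scope.

Section Reset.

Variables (V : finType) (S : V -> finType) (o : forall i : V, S i).

Lemma resetE (j i : V) (a : profile S) :
  reset o j a i = if i == j then o i else a i.
Proof.
rewrite /reset ffunE; case: eqVneq => [->|ne]; first exact: dfwith_in.
by apply: dfwith_out; rewrite eq_sym.
Qed.

Lemma foldr_resetE (s : seq V) (a : profile S) (i : V) :
  foldr (reset o) a s i = if i \in s then o i else a i.
Proof.
elim: s => //= j s IHs; rewrite resetE IHs in_cons.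
by case: eqP.
Qed.

Lemma restrict_reset (W : {set V}) (j : V) (a : profile S) :
  j \notin W -> restrict W (reset o j a) = restrict W a.
Proof.
move=> jW; apply/ffunP => k; rewrite [LHS]ffunE [RHS]ffunE resetE.
by case: eqP => // kj; rewrite -kj (valP k) in jW.
Qed.

Lemma restrict_eqP (W : {set V}) (a b : profile S) (i : V) :
  restrict W a = restrict W b -> i \in W -> a i = b i.
Proof.
move=> ab iW; move/ffunP/(_ (exist (fun j => j \in W) i iW)): ab.
by rewrite /restrict !ffunE.
Qed.

(* Resetting all coordinates outside [W] identifies profiles that agree on
   [W]. *)
Lemma reset_invariant_local (T : Type) (W : {set V}) (g : profile S -> T) :
  (forall j a, j \notin W -> g a = g (reset o j a)) ->
  forall a b, restrict W a = restrict W b -> g a = g b.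
Proof.
move=> g_reset a b ab.
have gE c : g c = g (foldr (reset o) c (enum (~: W))).
  (* Keeping only this inclusion lets the induction run over any list of coordinates outside [W]. *)
  have: {subset enum (~: W) <= ~: W} by move=> j; rewrite mem_enum.
  elim: (enum _) => //= j s IHs sW.
  rewrite -g_reset; last by rewrite -in_setC sW ?mem_head.
  by apply: IHs => k ks; rewrite sW // in_cons ks orbT.
rewrite gE [RHS]gE; congr g; apply/ffunP => i.
rewrite !foldr_resetE mem_enum in_setC.
by case: ifPn => // /negPn; apply: restrict_eqP.
Qed.

Lemma factor_restrict (T : Type) (W : {set V}) (g : profile S -> T) :
  (forall j a, j \notin W -> g a = g (reset o j a)) ->
  exists f : subprofile S W -> T, forall a, g a = f (restrict W a).
Proof.
move=> /reset_invariant_local g_local.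
(* [lift] picks any extension of [s]; locality of [g] makes the choice immaterial. The default [a0]
   is never reached on [restrict W a], which [a] itself extends. *)
pose a0 : profile S := [ffun i => o i].
pose lift (s : subprofile S W) : profile S :=
  odflt a0 [pick b : {dffun forall i, S i} | restrict W b == s].
exists (g \o lift) => a; apply: g_local; rewrite /lift.
by case: pickP => [b /eqP -> //|/(_ a)]; rewrite eqxx.
Qed.

End Reset.

Lemma max_clique_adj (V : finType) (e : rel V) (C : {set V}) (i j : V) :
  C \in max_cliques e -> i \in C -> j \in C -> i != j -> e i j.
Proof.
rewrite inE => /maxsetp /forall_inP Ccl iC jC.
by move/forall_inP: (Ccl _ iC) => /(_ _ jC) /implyP.
Qed.

Section CliqueSums.

Variables (R : realType) (V : finType) (e : rel V).
Variables (S : V -> finType) (o : forall i : V, S i).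
Variable PhiC : forall C : {set V}, subprofile S C -> R.

(** A clique through [i] cannot contain a non-neighbor [j], so no summand sees coordinate [j]. *)
Lemma clique_sum_reset (i j : V) (a : profile S) : i != j -> ~~ e i j ->
  \sum_(C in max_cliques e | i \in C) PhiC (restrict C (reset o j a)) =
  \sum_(C in max_cliques e | i \in C) PhiC (restrict C a).
Proof.
move=> ij eij; apply: eq_bigr => C /andP[Cmax iC]; rewrite restrict_reset //.
by apply: contra eij => jC; exact: (max_clique_adj Cmax).
Qed.

(** Serves both directions: it trades a difference of potentials for one of sums local to [i]. *)
Lemma clique_sum_diff (i : V) (a : profile S) :
  \sum_(C in max_cliques e | i \in C) PhiC (restrict C a) -
  \sum_(C in max_cliques e | i \in C) PhiC (restrict C (reset o i a)) =
  \sum_(C in max_cliques e) PhiC (restrict C a) -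
  \sum_(C in max_cliques e) PhiC (restrict C (reset o i a)).
Proof.
rewrite -!sumrB [RHS](bigID (fun C : {set V} => i \in C)) /=.
rewrite [X in _ = _ + X]big1 ?addr0 // => C /andP[_ iC].
by rewrite restrict_reset // subrr.
Qed.

End CliqueSums.

Theorem theorem4p5 (R : realType) (V : finType) (e : rel V)
    (e_sym : symmetric e) (e_irr : irreflexive e)
    (S : V -> finType) (o : forall i : V, S i)
    (PhiC : forall C : {set V}, subprofile S C -> R)
    (Phi : profile S -> R)
    (PhiE : forall a : profile S,
       Phi a = \sum_(C in max_cliques e) PhiC C (restrict C a)) :
  (forall f : (forall i : V, subprofile S (neighbors e i) -> R),
     graphical_game e o (clique_payoff PhiC f) /\
     potential_game o (clique_payoff PhiC f) Phi) /\
  (forall u : V -> profile S -> R,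
     graphical_game e o u -> potential_game o u Phi ->
     exists f : (forall i : V, subprofile S (neighbors e i) -> R),
       forall (i : V) (a : profile S), u i a = clique_payoff PhiC f i a).
Proof.
split=> [f|u u_graph u_pot].
  (* The [f i] term ignores the reset coordinate: by non-adjacency in the graphical part, by
     irreflexivity (last bullet) in the potential part. *)
  split=> [i j ij eij a|i a]; rewrite /clique_payoff restrict_reset ?inE //.
  - by rewrite clique_sum_reset.
  - by rewrite opprD addrACA subrr addr0 !PhiE clique_sum_diff.
  - by rewrite e_irr.
pose g i a := u i a - \sum_(C in max_cliques e | i \in C) PhiC C (restrict C a).
have g_reset i j a : j \notin neighbors e i -> g i a = g i (reset o j a).
  (* At [i] itself the potential equation applies; at another non-neighbor, the graphical condition
     does. *)
  rewrite inE /g; have [<- _|ij eij] := eqVneq i j; last first.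
    by rewrite -u_graph // clique_sum_reset.
  have := u_pot i a; rewrite !PhiE -clique_sum_diff => /eqP.
  by rewrite subr_eq => /eqP ->; rewrite addrC !addrA addNr add0r addrC.
(* Finite choice over [V] assembles the functions found player by player into one dependent
   family. *)
have /fin_all_exists [f fE] i := factor_restrict (@g_reset i).
by exists f => i a; rewrite /clique_payoff -fE addrC subrK.
Qed.
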